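(* Let $r\ge 3$ and let $\mathcal{H}$ be an $r$-uniform $r$-partite linear hypergraph (with a fixed partition of its vertex set into parts $V_1,\dots,V_r$) which contains no rainbow cycles of length three or four. Then $\mathcal{H}$ is $\mathcal{G}_r(3r-3,3)$-free, $\mathcal{G}_r(4r-5,4)$-free, $\mathcal{G}_r(5r-7,5)$-free, $\mathcal{G}_r(7r-11,7)$-free and $\mathcal{G}_r(8r-13,8)$-free.
   Context: A hypergraph is linear if any two distinct edges share at most one vertex. An $r$-uniform hypergraph is $r$-partite if its vertex set is partitioned into $r$ parts $V_1,\dots,V_r$ such that every edge contains exactly one vertex of each part. A cycle of length $k$ in a hypergraph is a sequence $v_1,A_1,v_2,A_2,\dots,v_k,A_k,v_1$ where $v_1,\dots,v_k$ are distinct vertices, $A_1,\dots,A_k$ are distinct edges, $v_i,v_{i+1}\in A_i$ for $1\le i\le k-1$ and $v_k,v_1\in A_k$. In an $r$-uniform $r$-partite linear hypergraph such a cycle is a rainbow $k$-cycle if $v_1,\dots,v_k$ lie in $k$ pairwise different parts. For integers $v,e$, an $r$-uniform hypergraph is $\mathcal{G}_r(v,e)$-free if the union of any $e$ distinct edges has at least $v+1$ vertices. *)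

(* Defs.v *)
From mathcomp Require Import all_boot.

Set Implicit Arguments.
Unset Strict Implicit.
Unset Printing Implicit Defensive.

(* A hypergraph on the finite vertex type T is given by its edge set
   E : {set {set T}}. *)
Section Hypergraph.
Variables (T : finType) (E : {set {set T}}).

Definition linear_hypergraph : Prop :=
  forall A B : {set T}, A \in E -> B \in E -> A != B -> #|A :&: B| <= 1.

Definition uniform (r : nat) : Prop :=
  forall A : {set T}, A \in E -> #|A| = r.

(* The parts are an indexed family; a part may be empty, which can happen only
   if there is no edge. *)
Definition partite (r : nat) (P : 'I_r -> {set T}) : Prop :=
  (forall x : T, exists! i : 'I_r, x \in P i) /\
  (forall A : {set T}, A \in E -> forall i : 'I_r, #|A :&: P i| = 1).

(* Indices are cyclic: [ordS i] is [i.+1 %% k], so the last edge contains the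
   last and the first vertex. *)
Definition is_cycle (k : nat) (v : 'I_k -> T) (A : 'I_k -> {set T}) : Prop :=
  [/\ injective v, injective A &
      forall i : 'I_k, [/\ A i \in E, v i \in A i & v (ordS i) \in A i]].

Definition rainbow_cycle (r : nat) (P : 'I_r -> {set T}) (k : nat)
    (v : 'I_k -> T) (A : 'I_k -> {set T}) : Prop :=
  is_cycle v A /\
  exists c : 'I_k -> 'I_r, injective c /\ forall i : 'I_k, v i \in P (c i).

Definition has_rainbow_cycle (r : nat) (P : 'I_r -> {set T}) (k : nat) : Prop :=
  exists (v : 'I_k -> T) (A : 'I_k -> {set T}), rainbow_cycle P v A.

Definition G_free (v e : nat) : Prop :=
  forall F : {set {set T}}, F \subset E -> #|F| = e -> v + 1 <= #|cover F|.

End Hypergraph.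

(* Main.v *)
Require Import Defs.
From mathcomp Require Import all_boot.
From mathcomp Require Import zify.

(* Write the defect of e edges as e r minus the size of their union; the bounds
   say that the defect is at most 2 (e - 2).  Deleting an edge A lowers it by
   the number of points of A lying on other edges, so induction works when some
   A has at most two such points.  Otherwise every edge has at least three; as
   triangles are always rainbow, e <= 8 then forces the intersection graph of
   the edges to be triangle-free, with minimum degree 3 and with as many graph
   edges as the defect.  The absence of rainbow 4-cycles bounds the number of
   common neighbours of two disjoint edges by 3.  Such graphs do not exist for
   e <= 5; for e = 6 the graph is K_{3,3} (the 3 x 3 grid, defect 9, which is why
   e = 6 is missing); for e = 7 they have at most 10 edges; and for e = 8 with
   more than 12 edges only K_{4,4} minus a matching of size 3 is left, on which
   the colours of the intersection points are contradictory. *)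

Set Implicit Arguments.
Unset Strict Implicit.
Unset Printing Implicit Defensive.

(** * Small triangle-free graphs of minimum degree three, and the crown graph *)

Section Graph.
Variables (V : finType) (adj : rel V).
Implicit Types (F : {set V}) (A B C : V).

Definition nbr F A : {set V} := [set B in F | adj A B].

Definition triangle_free F : Prop :=
  forall A B C, A \in F -> B \in F -> C \in F ->
    adj A B -> adj B C -> ~~ adj A C.

(** Graph-theoretic trace of the absence of rainbow 4-cycles; beyond it, colours are needed only to
    exclude the crown. *)
Definition few_common_nbrs F : Prop :=
  forall A B, A \in F -> B \in F -> A != B -> ~~ adj A B ->
    #|nbr F A :&: nbr F B| <= 3.

Hypothesis adjC : symmetric adj.

Lemma nbr_sub F A : nbr F A \subset F.
Proof. by apply/subsetP => B; rewrite inE => /andP[]. Qed.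

Lemma triangle_free_irr F A : triangle_free F -> A \in F -> ~~ adj A A.
Proof.
by move=> tf AF; apply/negP => AA; move: (tf _ _ _ AF AF AF AA AA); rewrite AA.
Qed.

Lemma nbr_disjoint F A B : triangle_free F -> A \in F -> B \in nbr F A ->
  nbr F B \subset F :\: nbr F A.
Proof.
move=> tf AF; rewrite inE => /andP[BF AB]; apply/subsetP => C.
rewrite !inE => /andP[CF BC]; rewrite CF andbT /=.
exact: tf AB BC.
Qed.

Lemma deg_add F A B : triangle_free F -> A \in F -> B \in nbr F A ->
  #|nbr F A| + #|nbr F B| <= #|F|.
Proof.
move=> tf AF AB; have := subset_leq_card (nbr_disjoint tf AF AB).
have := cardsID (nbr F A) F; rewrite (setIidPr (nbr_sub F A)); lia.
Qed.

(** Equality case of [deg_add]: two disjoint neighbourhoods that are large enough fill [F]. *)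
Lemma nbr_eq_compl F A B : triangle_free F -> A \in F -> B \in nbr F A ->
  #|F| <= #|nbr F A| + #|nbr F B| -> nbr F B = F :\: nbr F A.
Proof.
move=> tf AF AB le; apply/eqP; rewrite eqEcard (nbr_disjoint tf AF AB) /=.
have := cardsID (nbr F A) F; rewrite (setIidPr (nbr_sub F A)); lia.
Qed.

Section MinDegree3.
Variable F : {set V}.
Hypotheses (tf : triangle_free F) (deg3 : forall A, A \in F -> 3 <= #|nbr F A|).

Lemma nbr_ex A : A \in F -> exists B, B \in nbr F A.
Proof. by move=> AF; apply/card_gt0P; apply: leq_trans (deg3 AF). Qed.

Lemma deg_upper A : A \in F -> #|nbr F A| + 3 <= #|F|.
Proof.
move=> AF; have [B AB] := nbr_ex AF.
have := deg_add tf AF AB; have := deg3 (subsetP (nbr_sub _ _) _ AB); lia.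
Qed.

Lemma six_vertices_deg A : #|F| = 6 -> A \in F -> #|nbr F A| = 3.
Proof. by move=> F6 AF; have := deg_upper AF; have := deg3 AF; lia. Qed.

(** All degrees are 3, so neighbourhoods of adjacent vertices are complementary. Hence [B] is
    adjacent to any neighbour [X] of [A], and both neighbourhoods are the complement of that of
    [X]. *)
Lemma six_vertices_twins A B : #|F| = 6 -> A \in F -> B \in F -> ~~ adj A B ->
  nbr F A = nbr F B.
Proof.
move=> F6 AF BF nAB; have [X AX] := nbr_ex AF.
have XF := subsetP (nbr_sub _ _) _ AX.
have XA : A \in nbr F X by move: AX; rewrite !inE AF adjC => /andP[].
have eqA : nbr F A = F :\: nbr F X.
  by apply: nbr_eq_compl => //; rewrite !six_vertices_deg ?F6.
have XB : B \in nbr F X.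
  have := nbr_eq_compl tf AF AX; rewrite !six_vertices_deg ?F6 //.
  by move=> -> //; rewrite !inE BF nAB.
by rewrite eqA (nbr_eq_compl tf XF XB) // !six_vertices_deg ?F6.
Qed.

Hypothesis fc : few_common_nbrs F.

(** In case of equality every neighbour of [A] would be adjacent to everything outside [nbr F A]; a
    second vertex [C] there would share with [A] all of its at least four neighbours. *)
Lemma deg_tight A : A \in F -> 4 <= #|nbr F A| -> #|nbr F A| + 3 < #|F|.
Proof.
move=> AF A4; rewrite ltn_neqAle deg_upper // andbT; apply/eqP => Fe.
have nb B : B \in nbr F A -> nbr F B = F :\: nbr F A.
  move=> AB; apply: nbr_eq_compl => //; rewrite -Fe leq_add2l.
  exact: deg3 (subsetP (nbr_sub _ _) _ AB).
have cK : 1 < #|F :\: nbr F A|.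
  have := cardsID (nbr F A) F; rewrite (setIidPr (nbr_sub F A)); lia.
have [X [Y [XK YK XY]]] := card_gt1P cK.
have [C CK CA] : exists2 C, C \in F :\: nbr F A & A != C.
  by case: (eqVneq X A) XY => [->|XA _]; [exists Y | exists X; rewrite 1?eq_sym].
have [nAC CF] : ~~ adj A C /\ C \in F.
  by move: CK; rewrite !inE; case: (C \in F) => //= /andP[].
have := fc AF CF CA nAC; rewrite (setIidPl _); first by lia.
apply/subsetP => B AB; rewrite inE (subsetP (nbr_sub _ _) _ AB) adjC /=.
by have := CK; rewrite -(nb B AB) inE => /andP[].
Qed.

Lemma seven_vertices : #|F| = 7 -> \sum_(A in F) #|nbr F A| <= 21.
Proof.
move=> F7; have <- : \sum_(A in F) 3 = 21 by rewrite sum_nat_const F7.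
apply: leq_sum => A AF; rewrite leqNgt; apply/negP => A4.
by have := deg_tight AF A4; lia.
Qed.

(* The conclusion describes K_{4,4} minus a matching of size 3: every pair
   (R i, C j) is adjacent except possibly (R i, C i) with i > 0. *)
Lemma eight_vertices : #|F| = 8 -> 25 < \sum_(A in F) #|nbr F A| ->
  exists R C : 'I_4 -> V,
  [/\ injective R /\ injective C,
      forall i, R i \in F /\ C i \in F,
      forall i j, ~~ adj (R i) (R j),
      forall i j, ~~ adj (C i) (C j) &
      forall i j, (i == ord0) || (i != j) -> adj (R i) (C j)].
Proof.
move=> F8 sum_gt.
(* If all degrees were at most 3, the sum would be at most 24; degrees above 4 are excluded by
   [deg_tight]. *)
have [A AF A4] : exists2 A, A \in F & #|nbr F A| = 4.
  have [A A4|le] := pickP [pred A in F | 3 < #|nbr F A|]; last first.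
    suff : \sum_(A in F) #|nbr F A| <= \sum_(A in F) 3.
      by rewrite sum_nat_const F8; lia.
    by apply: leq_sum => A AF; move: (le A); rewrite /= AF /= ltnNge => /negbFE.
  have /andP[/= AF A4'] := A4; exists A => //.
  by have := deg_tight AF A4'; lia.
(* [N] and its complement [K], which contains [A], become the two sides. *)
set N := nbr F A in A4; pose K := F :\: N.
have NF : N \subset F := nbr_sub F A.
have K4 : #|K| = 4 by have := cardsID N F; rewrite (setIidPr NF) -/K A4 F8; lia.
have AK : A \in K by rewrite !inE AF (negbTE (triangle_free_irr tf AF)).
have KF C : C \in K -> C \in F by rewrite inE => /andP[].
have KN C : C \in K -> ~~ adj A C by rewrite !inE; case: (C \in F); rewrite ?andbF ?andbT.
have NK B : B \in N -> nbr F B \subset K by move=> BN; apply: nbr_disjoint.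
have NA B : B \in N -> adj B A by rewrite inE adjC => /andP[].
have N3 B : B \in N -> 3 <= #|nbr F B| by move=> BN; apply: deg3 (subsetP NF _ BN).
(* Otherwise [A] and [C] would have all four elements of [N] in common. *)
have nN C : C \in K -> C != A -> exists2 B, B \in N & ~~ adj B C.
  move=> CK CA; have := fc AF (KF C CK); rewrite eq_sym CA => /(_ isT (KN _ CK)).
  rewrite leqNgt => H; have [B BN|all] := pickP [pred B in N | ~~ adj B C].
    by exists B; case/andP: BN.
  case/negP: H; rewrite (setIidPl _) ?A4 //; apply/subsetP => B BN.
  rewrite inE (subsetP NF _ BN) adjC; move: (all B); rewrite /= BN /=.
  by move/negbFE.
(* [B] has at least three neighbours, all among the four elements of [K]. *)
have miss1 B C C' : B \in N -> C \in K -> C' \in K -> C != C' -> ~~ adj B C ->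
    adj B C'.
  move=> BN CK C'K CC' nBC; apply/negPn/negP => nBC'.
  have : nbr F B \subset K :\: [set C; C'].
    apply/subsetP => D DB; rewrite in_setD (subsetP (NK _ BN) _ DB) andbT !inE.
    apply/negP => /orP[]/eqP e; move: DB;
      by rewrite e inE ?(negbTE nBC) ?(negbTE nBC') andbF.
  move/subset_leq_card; have := N3 _ BN; have := cardsID [set C; C'] K.
  rewrite (setIidPr _); first by rewrite cards2 CC' K4; lia.
  by apply/subsetP => D; rewrite in_set2 => /orP[]/eqP->.
(* Some [B] in [N] misses a fourth vertex [D] of [K], hence is adjacent to both [C] and [C']; an
   edge between these would close a triangle. *)
have Kind C C' : C \in K -> C' \in K -> ~~ adj C C'.
  move=> CK C'K; apply/negP => CC'.
  have CA : C != A by apply: contraTneq CC' => ->; apply: KN.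
  have C'A : C' != A by apply: contraTneq CC' => ->; rewrite adjC; apply: KN.
  have Cne : C != C'.
    by apply: contraTneq CC' => ->; apply: triangle_free_irr tf (KF _ C'K).
  have [D DK DA] : exists2 D, D \in K & [&& D != A, D != C & D != C'].
    have : 0 < #|K :\: [set A; C; C']|.
      have := cardsID [set A; C; C'] K; have := subset_leq_card (subsetIr K [set A; C; C']).
      have : #|[set A; C; C']| <= 3.
        by rewrite -setUA cardsU1 cards2; case: (_ \notin _); case: (_ != _).
      lia.
    case/card_gt0P=> D; rewrite in_setD => /andP[nD DK]; exists D => //.
    by move: nD; rewrite !in_setU !in_set1 !negb_or -andbA.
  have [DA' DC DC'] := and3P DA.
  have [B BN /negP nBD] := nN D DK DA'; apply: nBD.
  case BC: (adj B C); last by apply: (miss1 B C D) => //; rewrite ?BC // eq_sym.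
  case BC': (adj B C'); last by apply: (miss1 B C' D) => //; rewrite ?BC' // eq_sym.
  by have := tf (subsetP NF _ BN) (KF _ CK) (KF _ C'K) BC CC'; rewrite BC'.
have KdegN C : C \in K -> nbr F C \subset N.
  move=> CK; apply/subsetP => B; rewrite inE => /andP[BF CB]; apply/negPn/negP => BN.
  by move: (Kind C B CK); rewrite CB => /(_ _)/negP; apply; rewrite // inE BN.
(* This is where 25 comes from: without such a [B0], [N] contributes at most 12 and [K] at most 4 +
   9. *)
have [B0 B0N B04] : exists2 B, B \in N & 3 < #|nbr F B|.
  have [B BP|le] := pickP [pred B in N | 3 < #|nbr F B|]; first by exists B; case/andP: BP.
  have sN : \sum_(B in N) #|nbr F B| <= \sum_(B in N) 3.
    by apply: leq_sum => B BN; move: (le B); rewrite /= BN /= ltnNge => /negbFE.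
  have sK : \sum_(C in K) #|nbr F C| <= 4 + \sum_(C in K :\ A) 3.
    rewrite (big_setD1 A) //= -/N A4 leq_add2l; apply: leq_sum => C.
    rewrite in_setD1 => /andP[CA CK]; have := fc AF (KF _ CK).
    rewrite eq_sym CA => /(_ isT (KN _ CK)); rewrite (setIidPr _) //; exact: KdegN.
  move: sum_gt; rewrite (big_setID N) /= (setIidPr NF) -/K.
  move: sN sK; rewrite !sum_nat_const A4; have := cardsD1 A K; rewrite AK K4.
  lia.
have B0K C : C \in K -> adj B0 C.
  have /eqP -> : K == nbr F B0 by rewrite eq_sym eqEcard (NK _ B0N) K4.
  by rewrite inE => /andP[].
(* A non-neighbour in [N] of a vertex of [K]; [A] has none, and the default [B0], adjacent to all of
   [K], becomes its partner. *)
pose m C := odflt B0 [pick B in N | ~~ adj B C].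
have mN C : m C \in N by rewrite /m; case: pickP => [B /andP[]|].
have mA : m A = B0.
  by rewrite /m; case: pickP => [B /andP[/NA ->]|].
have mC C : C \in K -> C != A -> ~~ adj (m C) C.
  move=> CK CA; rewrite /m; case: pickP => [B /andP[]|] // no.
  by have [B BN BC] := nN C CK CA; move: (no B); rewrite /= BN BC.
have madj C C' : C \in K -> C' \in K -> (C == A) || (C != C') -> adj (m C) C'.
  move=> CK C'K; case: (eqVneq C A) => [-> _|CA] /=; first by rewrite mA B0K.
  by move=> CC'; apply: (miss1 _ C) => //; apply: mC.
have m_inj C C' : C \in K -> C' \in K -> m C = m C' -> C = C'.
  move=> CK C'K e; apply/eqP/negPn/negP => CC'.
  case: (eqVneq C' A) => [C'A|C'A]; last first.
    by have := mC _ C'K C'A; rewrite -e madj // CC' orbT.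
  have CA : C != A by rewrite -C'A.
  by have := mC _ CK CA; rewrite e madj // C'A eqxx.
have K'3 : 2 < #|K :\ A| by have := cardsD1 A K; rewrite AK K4; lia.
have [C1 [C2 [C3 [[]]]]] := card_gt2P K'3.
rewrite !in_setD1 => /andP[C1A C1K] /andP[C2A C2K] /andP[C3A C3K] [C12 C23 C31].
(* [A] comes first so that index 0 carries the adjacent pair [B0], [A]. *)
pose t := [tuple A; C1; C2; C3]; pose C i := tnth t i.
have C_inj : injective C.
  apply/tuple_uniqP; rewrite /= !inE !negb_or.
  by rewrite ![A == _]eq_sym C1A C2A C3A C12 C23 eq_sym C31.
have CK i : C i \in K.
  have : [|| C i == A, C i == C1, C i == C2 | C i == C3].
    by have := mem_tnth i t; rewrite !inE.
  by case/or4P => /eqP->.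
exists (m \o C), C; split=> [|i|i j|i j|i j ij] /=.
- by split=> // i j /= /m_inj e; apply/C_inj/e.
- by split; [apply: (subsetP NF) | apply: KF].
- apply/negP => ad.
  have := tf AF (subsetP NF _ (mN (C i))) (subsetP NF _ (mN (C j))).
  rewrite ad adjC NA // => /(_ isT isT)/negP; apply; by rewrite adjC NA.
- exact: Kind.
- apply: madj => //; rewrite (inj_eq C_inj) (_ : A = C ord0) ?(inj_eq C_inj) //.
Qed.
End MinDegree3.
End Graph.

(** Compared with the full row 0, the three [quad] alternatives for a row i > 0 must be met by three
    different cells, so on the columns other than i that row is a cyclic shift of row 0.
    Distinctness in column 0 leaves two ways to choose the three shifts, and both violate [quad] for
    rows 1 and 2 in columns 0 and 3. *)
Lemma no_crown_coloring (X : Type) (a : 'I_4 -> 'I_4 -> X)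
    (p := fun i j : 'I_4 => (i == ord0) || (i != j)) :
  (forall i j k, p i j -> p i k -> j != k -> a i j <> a i k) ->
  (forall i j k, p j i -> p k i -> j != k -> a j i <> a k i) ->
  (forall i j k l, p i k -> p i l -> p j k -> p j l -> i != j -> k != l ->
     a i k = a j l \/ a i l = a j k) -> False.
Proof.
set o0 : 'I_4 := ord0; pose o1 : 'I_4 := @Ordinal 4 1 isT.
pose o2 : 'I_4 := @Ordinal 4 2 isT; pose o3 : 'I_4 := @Ordinal 4 3 isT.
move=> row col quad.
have r0 j k (jk : j != k) := row o0 j k isT isT jk.
have r01 := r0 o0 o1 isT; have r02 := r0 o0 o2 isT; have r03 := r0 o0 o3 isT.
have r12 := r0 o1 o2 isT; have r13 := r0 o1 o3 isT; have r23 := r0 o2 o3 isT.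
have c12 := col o0 o1 o2 isT isT isT; have c13 := col o0 o1 o3 isT isT isT.
have c23 := col o0 o2 o3 isT isT isT.
have q i (ip : o0 != i) k l (ik : p i k) (il : p i l) (kl : k != l) :=
  quad o0 i k l isT isT ik il ip kl.
have s1 := row o1 o0 o2 isT isT isT; have s2 := row o1 o0 o3 isT isT isT.
have s3 := row o1 o2 o3 isT isT isT.
have t1 := row o2 o0 o1 isT isT isT; have t2 := row o2 o0 o3 isT isT isT.
have t3 := row o2 o1 o3 isT isT isT.
have u1 := row o3 o0 o1 isT isT isT; have u2 := row o3 o0 o2 isT isT isT.
have u3 := row o3 o1 o2 isT isT isT.
have q12 := quad o1 o2 o0 o3 isT isT isT isT isT isT.
case: (q o1 isT o0 o2 isT isT isT) => e1;
case: (q o1 isT o0 o3 isT isT isT) => e2;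
case: (q o1 isT o2 o3 isT isT isT) => e3; try congruence;
case: (q o2 isT o0 o1 isT isT isT) => e4;
case: (q o2 isT o0 o3 isT isT isT) => e5;
case: (q o2 isT o1 o3 isT isT isT) => e6; try congruence;
case: (q o3 isT o0 o1 isT isT isT) => e7;
case: (q o3 isT o0 o2 isT isT isT) => e8;
case: (q o3 isT o1 o2 isT isT isT) => e9; try congruence;
case: q12 => e10; congruence.
Qed.

(** * The intersection graph of a linear hypergraph *)

Definition meets (T : finType) : rel {set T} :=
  [rel A B | (A != B) && (A :&: B != set0)].

Section LinearHypergraph.
Variables (T : finType) (E : {set {set T}}).
Implicit Types (A B C D X : {set T}) (F : {set {set T}}).

Lemma meetsC : symmetric (@meets T).
Proof. by move=> A B; rewrite /meets /= eq_sym setIC. Qed.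

Lemma meetsP A B : reflect (A != B /\ exists x, x \in A /\ x \in B) (meets A B).
Proof.
apply: (iffP andP) => [[AB /set0Pn[x]]|[AB [x [xA xB]]]].
  by rewrite inE => /andP[]; split=> //; exists x.
by split=> //; apply/set0Pn; exists x; rewrite inE xA.
Qed.

Lemma meets_at A B x : A != B -> x \in A -> x \in B -> meets A B.
Proof. by move=> AB xA xB; apply/meetsP; split=> //; exists x. Qed.

Lemma not_meets A B x : A != B -> ~~ meets A B -> x \in A -> x \in B -> False.
Proof. by move=> AB nAB xA xB; rewrite (meets_at AB xA xB) in nAB. Qed.

Definition shared F A : nat := #|A :&: cover (F :\ A)|.

Lemma coverD1 F A : A \in F ->
  #|cover F| + shared F A = #|cover (F :\ A)| + #|A|.
Proof. by move=> AF; rewrite /cover (big_setD1 A) //= cardsUI addnC. Qed.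

Lemma mem_shared F A x : reflect
  (x \in A /\ exists2 D, D \in nbr (@meets T) F A & x \in D)
  (x \in A :&: cover (F :\ A)).
Proof.
rewrite inE; apply: (iffP andP) => -[xA].
  case/bigcupP => D; rewrite in_setD1 => /andP[DA DF] xD; split=> //.
  by exists D; rewrite // inE DF (@meets_at _ _ x) // eq_sym.
case=> D; rewrite inE => /andP[DF /andP[/= AD _]] xD; split=> //.
by apply/bigcupP; exists D; rewrite // in_setD1 eq_sym AD.
Qed.

Hypothesis lin : linear_hypergraph E.

Lemma linear_eq A B x y : A \in E -> B \in E -> A != B ->
  x \in A -> x \in B -> y \in A -> y \in B -> x = y.
Proof.
move=> AE BE AB xA xB yA yB; have /card_le1_eqP := lin AE BE AB.
by apply; rewrite inE ?xA ?yA.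
Qed.

(** Sending each point of [X] to a second edge through it is injective, since by linearity that edge
    has no other point on [A]. *)
Lemma card_shared_sub F A X : F \subset E -> A \in F ->
  X \subset A :&: cover (F :\ A) ->
  #|X| <= #|[set D in nbr (@meets T) F A | D :&: X != set0]|.
Proof.
move=> FE AF XA.
pose h x := odflt A [pick D in nbr (@meets T) F A | x \in D].
have hP x : x \in X -> [/\ h x \in nbr (@meets T) F A, x \in h x & x \in A].
  move=> /(subsetP XA)/mem_shared[xA [D DN xD]]; rewrite /h.
  by case: pickP => [D' /andP[]|/(_ D)]; rewrite ?DN ?xD.
rewrite -(card_in_imset (f := h)) => [|x y /hP[hx xh xA] /hP[hy yh yA] e].
  apply/subset_leq_card/subsetP => _ /imsetP[x xX ->]; have [hx xh _] := hP x xX.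
  by rewrite inE hx; apply/set0Pn; exists x; rewrite inE xh.
move: hx; rewrite inE => /andP[hF /andP[/= Ah _]].
by apply: (linear_eq (subsetP FE _ AF) (subsetP FE _ hF) Ah) => //; rewrite e.
Qed.

Lemma shared_le_nbr F A : F \subset E -> A \in F ->
  shared F A <= #|nbr (@meets T) F A|.
Proof.
move=> FE AF; apply: leq_trans (card_shared_sub FE AF (subxx _)) _.
by apply/subset_leq_card/subsetP => D; rewrite inE => /andP[].
Qed.

Lemma nbr_subD1 F A : nbr (@meets T) F A \subset F :\ A.
Proof.
by apply/subsetP => B; rewrite inE in_setD1 eq_sym => /and3P[-> ->].
Qed.

Lemma shared_lt F A : F \subset E -> A \in F -> shared F A < #|F|.
Proof.
move=> FE AF; apply: leq_ltn_trans (shared_le_nbr FE AF) _.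
by rewrite (cardsD1 A F) AF ltnS (subset_leq_card (nbr_subD1 F A)).
Qed.

(** The form in which the absence of rainbow triangles is used: pairwise meeting edges are
    concurrent. *)
Hypothesis tri : forall A B C x y, A \in E -> B \in E -> C \in E ->
  meets A C -> A != B -> B != C ->
  x \in A -> x \in B -> y \in B -> y \in C -> x = y.

(* The lines through a point of degree d >= 3, together with the lines leaving
   them elsewhere, are at least 3d lines. *)
Lemma meets_triangle_free F : F \subset E -> #|F| <= 8 ->
  (forall A, A \in F -> 3 <= shared F A) -> triangle_free (@meets T) F.
Proof.
move=> FE F8 sh A B C AF BF CF AB BC; apply/negP => AC.
have [[AE BE] CE] := (subsetP FE _ AF, subsetP FE _ BF, subsetP FE _ CF).
have /meetsP[nAB [x [xA xB]]] := AB; have /meetsP[nBC [y [yB yC]]] := BC.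
have nAC : A != C by case/andP: AC.
(* [tri] turns the triangle into three edges through the single point [x]. *)
have xC : x \in C by rewrite (tri AE BE CE AC nAB nBC xA xB yB yC).
pose L D : {set {set T}} := [set D' in nbr (@meets T) F D | x \notin D'].
have L2 D : D \in F -> x \in D -> 2 <= #|L D|.
  move=> DF xD; have DE := subsetP FE _ DF.
  pose X := D :&: cover (F :\ D).
  have X2 : 2 <= #|X :\ x|.
    by have := sh D DF; rewrite /shared (cardsD1 x); case: (x \in _) => // /ltnW.
  apply: (leq_trans X2); apply: leq_trans (card_shared_sub FE DF (subD1set _ x)) _.
  apply/subset_leq_card/subsetP => D'.
  rewrite inE => /andP[D'N /set0Pn[z]].
  rewrite in_setI in_setD1 in_setI => /and4P[zD' zx zD _].
  rewrite inE D'N; apply: contra zx => xD'; apply/eqP.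
  have := D'N; rewrite inE => /andP[D'F /andP[/= DD' _]].
  exact: (linear_eq DE (subsetP FE _ D'F) DD').
(* A common element would form a triangle with [D] and [D'], hence pass through [x]. *)
have Ldis D D' : D \in F -> D' \in F -> D != D' -> x \in D -> x \in D' ->
    [disjoint L D & L D'].
  move=> DF D'F DD' xD xD'; rewrite -setI_eq0; apply/eqP/setP => G.
  rewrite in_set0; apply/negP; rewrite !inE => /andP[/andP[/andP[GF /meetsP[DG [u [uD uG]]]] xG]].
  case/andP=> /andP[_ /meetsP[D'G [v [vD' vG]]]] _.
  have [[DE D'E] GE] := (subsetP FE _ DF, subsetP FE _ D'F, subsetP FE _ GF).
  have GD' : meets G D' by apply: (@meets_at _ _ v); rewrite // eq_sym.
  move/negP: xG; apply; rewrite -(tri GE DE D'E GD' _ DD' uG uD xD xD') //.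
  by rewrite eq_sym.
pose S : {set {set T}} := [set A; B; C].
have Sdis D : [disjoint S & L D].
  rewrite -setI_eq0; apply/eqP/setP => G; rewrite in_set0; apply/negP.
  rewrite in_setI => /andP[GS]; rewrite inE => /andP[_ /negP]; apply.
  by move: GS; rewrite !inE -orbA => /or3P[]/eqP->.
have S3 : #|S| = 3.
  by rewrite /S -setUA cardsU1 cards2 !inE negb_or nAB nAC nBC.
have sub : S :|: L A :|: L B :|: L C \subset F.
  rewrite /S !subUset !sub1set AF BF CF /=.
  by rewrite -!andbA; apply/and3P; split; apply/subsetP => D; rewrite !inE => /andP[/andP[]].
clearbody S L; have := subset_leq_card sub.
have dis1 : (S :|: L A) :&: L B = set0.
  apply/eqP; rewrite setIUl setU_eq0 !setI_eq0 Sdis /=; exact: Ldis.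
have dis2 : (S :|: L A :|: L B) :&: L C = set0.
  apply/eqP; rewrite !setIUl !setU_eq0 !setI_eq0 Sdis /=.
  by rewrite !Ldis // eq_sym.
have dis0 : S :&: L A = set0 by apply/eqP; rewrite setI_eq0.
rewrite !cardsU dis2 dis1 dis0 cards0 S3 !subn0 => le8.
(* The three edges and two more leaving each of them already make nine. *)
have ge9 : 3 + 2 + 2 + 2 <= 3 + #|L A| + #|L B| + #|L C|.
  by rewrite !leq_add ?L2.
by have := leq_trans ge9 (leq_trans le8 F8).
Qed.

(** * Counting points by their degree *)

Definition degree F x := #|[set A in F | x \in A]|.

Lemma sum_card_degree F X :
  \sum_(A in F) #|A :&: X| = \sum_(x in X) degree F x.
Proof.
transitivity (\sum_(A in F) \sum_(x in X) (x \in A : nat)).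
  apply: eq_bigr => A _; rewrite -sum1_card -big_mkcondr /=.
  by apply: eq_bigl => x; rewrite inE andbC.
rewrite exchange_big; apply: eq_bigr => x _.
rewrite /degree -sum1_card -big_mkcondr /=.
by apply: eq_bigl => A; rewrite inE.
Qed.

Lemma degree_gt1P F x A : A \in F -> x \in A ->
  (1 < degree F x) = (x \in A :&: cover (F :\ A)).
Proof.
move=> AF xA; rewrite /degree (cardsD1 A) inE AF xA ltnS inE xA /=.
apply/card_gt0P/bigcupP => [[D]|[D]].
  by rewrite in_setD1 inE => /and3P[DA DF xD]; exists D => //; rewrite in_setD1 DA.
by rewrite in_setD1 => /andP[DA DF] xD; exists D; rewrite in_setD1 inE DA DF.
Qed.

Lemma degree_le2 F x : triangle_free (@meets T) F -> degree F x <= 2.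
Proof.
move=> tf; rewrite leqNgt; apply/negP => /card_gt2P[A [B [C [[]]]]].
rewrite !inE => /andP[AF xA] /andP[BF xB] /andP[CF xC] [AB BC CA].
have := tf A B C AF BF CF (meets_at AB xA xB) (meets_at BC xB xC).
by rewrite (@meets_at _ _ x) // eq_sym.
Qed.

(** A point of degree d <= 1 satisfies 2d <= 2, and one of degree 2 satisfies 2d = 2 + d. The extra
    terms d add up to the numbers of shared points, each at most a degree in the intersection
    graph. *)
Lemma handshake F : F \subset E -> triangle_free (@meets T) F ->
  2 * \sum_(A in F) #|A| <=
    2 * #|cover F| + \sum_(A in F) #|nbr (@meets T) F A|.
Proof.
move=> FE tf; pose D2 := [set x | 1 < degree F x].
have eA : \sum_(A in F) #|A| = \sum_(x in cover F) degree F x.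
  rewrite -sum_card_degree; apply: eq_bigr => A AF.
  by rewrite (setIidPl _) //; apply: bigcup_sup.
have eS : \sum_(A in F) shared F A = \sum_(x in D2) degree F x.
  rewrite -sum_card_degree; apply: eq_bigr => A AF; congr #|pred_of_set _|.
  apply/setP => x; rewrite [RHS]inE [_ \in D2]inE; case xA: (x \in A) => /=.
    by rewrite (degree_gt1P AF).
  by rewrite inE xA.
apply: (@leq_trans (2 * #|cover F| + \sum_(A in F) shared F A)); last first.
  by rewrite leq_add2l; apply: leq_sum => A AF; apply: shared_le_nbr.
rewrite eA eS -sum1_card !big_distrr /= [X in _ <= _ + X]big_mkcond /=.
rewrite [X in X <= _]big_mkcond [X in _ <= X + _]big_mkcond -big_split /=.
apply: leq_sum => x _; rewrite inE; have := degree_le2 x tf.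
case: (x \in cover F) => //=.
by case: (degree F x) => [|[|[|]]].
Qed.

(** * Colours of the intersection points *)

Section Coloring.
Variables (I : eqType) (col : T -> I).
Hypothesis col_inj : forall A x y, A \in E -> x \in A -> y \in A -> x != y ->
  col x != col y.
(** The form in which the absence of rainbow 4-cycles is used; [x], [y], [z], [w] are the corners of
    a quadrilateral in cyclic order. *)
Hypothesis quad : forall A B C D x y z w,
  A \in E -> B \in E -> C \in E -> D \in E ->
  A != C -> ~~ meets A C -> B != D -> ~~ meets B D ->
  x \in A -> x \in B -> y \in B -> y \in C ->
  z \in C -> z \in D -> w \in D -> w \in A -> col x = col z \/ col y = col w.

(** An option, so that disjoint edges need no default colour; for distinct meeting edges linearity
    makes the picked point the only choice. *)
Definition meet_col A B := omap col [pick x in A :&: B].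

Lemma meet_colC A B : meet_col A B = meet_col B A.
Proof. by rewrite /meet_col setIC. Qed.

Lemma meet_colE A B x : A \in E -> B \in E -> A != B -> x \in A -> x \in B ->
  meet_col A B = Some (col x).
Proof.
move=> AE BE AB xA xB; rewrite /meet_col; case: pickP => [y|/(_ x)].
  rewrite inE => /andP[yA yB] /=.
  by rewrite (linear_eq AE BE AB xA xB yA yB).
by rewrite inE xA xB.
Qed.

Lemma meet_col_neq A B C : A \in E -> B \in E -> C \in E ->
  meets A B -> meets A C -> B != C -> ~~ meets B C ->
  meet_col A B <> meet_col A C.
Proof.
move=> AE BE CE /meetsP[AB [x [xA xB]]] /meetsP[AC [y [yA yC]]] BC nBC.
rewrite (meet_colE AE BE AB xA xB) (meet_colE AE CE AC yA yC) => -[] e.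
have xy : x != y by apply: contraNneq nBC => xy; apply: (meets_at BC xB); rewrite xy.
by have := col_inj AE xA yA xy; rewrite e eqxx.
Qed.

Lemma meet_col_quad A B C D : A \in E -> B \in E -> C \in E -> D \in E ->
  meets A B -> meets B C -> meets C D -> meets D A ->
  A != C -> ~~ meets A C -> B != D -> ~~ meets B D ->
  meet_col A B = meet_col C D \/ meet_col B C = meet_col D A.
Proof.
move=> AE BE CE DE /meetsP[AB [x [xA xB]]] /meetsP[BC [y [yB yC]]].
move=> /meetsP[CD [z [zC zD]]] /meetsP[DA [w [wD wA]]] AC nAC BD nBD.
rewrite (meet_colE AE BE AB xA xB) (meet_colE BE CE BC yB yC).
rewrite (meet_colE CE DE CD zC zD) (meet_colE DE AE DA wD wA).
by case: (quad AE BE CE DE AC nAC BD nBD xA xB yB yC zC zD wD wA) => ->; [left|right].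
Qed.

(** If [C] and [D] met, [tri] would put their common point on both [A] and [B]. *)
Lemma common_nbrs_not_meet A B C D : A \in E -> B \in E -> C \in E -> D \in E ->
  A != B -> ~~ meets A B -> C != D ->
  meets A C -> meets A D -> meets B C -> meets B D -> ~~ meets C D.
Proof.
move=> AE BE CE DE AB nAB CD /meetsP[AC [x [xA xC]]] /meetsP[AD [y [yA yD]]].
move=> /meetsP[BC [u [uB uC]]] /meetsP[BD [v [vB vD]]].
apply/negP => mCD; have CA : C != A by rewrite eq_sym.
have CB : C != B by rewrite eq_sym.
have xy : x = y := tri CE AE DE mCD CA AD xC xA yA yD.
have uv : u = v := tri CE BE DE mCD CB BD uC uB vB vD.
subst y v; have xu := linear_eq CE DE CD xC yD uC vD.
by subst u; case: (not_meets AB nAB xA uB).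
Qed.

(* If A and B are disjoint with common neighbours C, D1, D2, D3, each of the
   quadrilaterals A C B Di forces A.C ~ B.Di or B.C ~ A.Di (~ is equality of
   colours), and each alternative can hold for at most one i. *)
Lemma card_common_nbrs F A B : F \subset E -> A \in E -> B \in E -> A != B ->
  ~~ meets A B -> #|nbr (@meets T) F A :&: nbr (@meets T) F B| <= 3.
Proof.
move=> FE AE BE AB nAB; rewrite leqNgt; apply/negP => gt3.
set S := _ :&: _ in gt3.
have SP C : C \in S -> [/\ C \in E, meets A C & meets B C].
  by rewrite inE => /andP[]; rewrite !inE => /andP[/(subsetP FE) -> ->] /andP[_ ->].
have SS C D : C \in S -> D \in S -> C != D -> ~~ meets C D.
  move=> /SP[CE AC BC] /SP[DE AD BD] CD.
  exact: common_nbrs_not_meet AB nAB CD AC AD BC BD.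
have [C CS] : exists C, C \in S by apply/card_gt0P; apply: leq_trans gt3.
have : 2 < #|S :\ C| by have := cardsD1 C S; rewrite CS; lia.
case/card_gt2P => [D1 [D2 [D3 [[]]]]]; rewrite !in_setD1.
move=> /andP[D1C D1S] /andP[D2C D2S] /andP[D3C D3S] [D12 D23 D31].
have cross D : D \in S -> D != C ->
    meet_col A C = meet_col B D \/ meet_col B C = meet_col A D.
  move=> DS DC; have [CE AC BC] := SP C CS; have [DE AD BD] := SP D DS.
  rewrite (meet_colC B C) (meet_colC A D).
  have CD : C != D by rewrite eq_sym.
  by apply: meet_col_quad => //; rewrite 1?meetsC // SS.
have dist X C1 C2 : X \in [set A; B] -> C1 \in S -> C2 \in S -> C1 != C2 ->
    meet_col X C1 <> meet_col X C2.
  move=> XAB C1S C2S C12; have [C1E AC1 BC1] := SP _ C1S.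
  have [C2E AC2 BC2] := SP _ C2S; apply: meet_col_neq => //; last exact: SS.
  - by case/set2P: XAB => ->.
  - by case/set2P: XAB => ->.
  - by case/set2P: XAB => ->.
have dA := dist A _ _ (set21 _ _); have dB := dist B _ _ (set22 _ _).
have A12 := dA _ _ D1S D2S D12; have A23 := dA _ _ D2S D3S D23.
have A31 := dA _ _ D3S D1S D31; have B12 := dB _ _ D1S D2S D12.
have B23 := dB _ _ D2S D3S D23; have B31 := dB _ _ D3S D1S D31.
case: (cross _ D1S D1C) (cross _ D2S D2C) (cross _ D3S D3C) => ? [] ? [] ?;
  congruence.
Qed.

Lemma no_crown (R C : 'I_4 -> {set T}) :
  injective R -> injective C ->
  (forall i, R i \in E /\ C i \in E) ->
  (forall i j, ~~ meets (R i) (R j)) -> (forall i j, ~~ meets (C i) (C j)) ->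
  ~ (forall i j, (i == ord0) || (i != j) -> meets (R i) (C j)).
Proof.
move=> Rinj Cinj RCE RR CC RC.
have RE i : R i \in E by case: (RCE i).
have CE i : C i \in E by case: (RCE i).
have CR i j : (i == ord0) || (i != j) -> meets (C j) (R i).
  by rewrite meetsC; apply: RC.
apply: (@no_crown_coloring _ (fun i j => meet_col (R i) (C j))).
- move=> i j k ij ik jk.
  by apply: meet_col_neq; rewrite ?RC // (inj_eq Cinj).
- move=> i j k ji ki jk; rewrite 2!(meet_colC _ (C i)).
  by apply: meet_col_neq; rewrite ?CR // (inj_eq Rinj).
- move=> i j k l ik il jk jl ij kl.
  have [e|e] : meet_col (R i) (C k) = meet_col (R j) (C l) \/
               meet_col (C k) (R j) = meet_col (C l) (R i).
    by apply: meet_col_quad; rewrite ?RC ?CR // ?(inj_eq Rinj) ?(inj_eq Cinj).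
  + by left.
  + by right; rewrite (meet_colC (R j)) (meet_colC (R i)).
Qed.

(** * Defect bounds by induction on the number of edges *)

Variable r : nat.
Hypothesis unif : uniform E r.

(** Additive form of the defect bound, free of truncated subtraction. *)
Definition defect_le F m := #|F| * r <= #|cover F| + m.

Lemma defect_leD1 F A m k : F \subset E -> A \in F ->
  defect_le (F :\ A) m -> shared F A <= k -> defect_le F (m + k).
Proof.
rewrite /defect_le => FE AF; have := coverD1 AF; rewrite (unif (subsetP FE _ AF)).
rewrite (cardsD1 A F) AF mulnDl mul1n.
by move: (shared F A) (_ * r) #|cover F| #|cover _| => *; lia.
Qed.

Lemma shared_dichotomy F :
  (exists2 A, A \in F & shared F A <= 2) \/ (forall A, A \in F -> 3 <= shared F A).
Proof.
have [A /andP[AF sA]|no] := pickP [pred A in F | shared F A <= 2].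
  by left; exists A.
by right=> A AF; move: (no A); rewrite /= AF /= leqNgt => /negbFE.
Qed.

(** The last edge shares nothing, and the one deleted before it at most one point; [.-1] also covers
    the empty family. *)
Lemma defect_le_small F : F \subset E -> #|F| <= 2 -> defect_le F #|F|.-1.
Proof.
case: (set_0Vmem F) => [->|[A AF]] FE; first by rewrite /defect_le cards0.
have F1 := cardsD1 A F; rewrite AF in F1.
have sF := shared_lt FE AF => F2.
have -> : #|F|.-1 = 0 + #|F|.-1 by [].
apply: (defect_leD1 FE AF); last by lia.
case: (set_0Vmem (F :\ A)) => [->|[B BF]]; first by rewrite /defect_le cards0.
have F'E : F :\ A \subset E by apply: subset_trans FE; apply: subD1set.
have -> : 0 = 0 + 0 by []; apply: (defect_leD1 F'E BF); last first.
  by have := shared_lt F'E BF; lia.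
have := cardsD1 B (F :\ A); rewrite BF => F1'.
have F''0 : #|F :\ A :\ B| = 0 by move: F2; rewrite F1 F1'; case: #|_|.
by rewrite /defect_le F''0.
Qed.

Section Dense.
Variable F : {set {set T}}.
Hypotheses (FE : F \subset E) (F8 : #|F| <= 8).
Hypothesis sh : forall A, A \in F -> 3 <= shared F A.

Lemma dense_triangle_free : triangle_free (@meets T) F.
Proof. exact: meets_triangle_free. Qed.

Lemma dense_deg A : A \in F -> 3 <= #|nbr (@meets T) F A|.
Proof. by move=> AF; apply: leq_trans (sh AF) (shared_le_nbr FE AF). Qed.

Lemma dense_few_common_nbrs : few_common_nbrs (@meets T) F.
Proof. by move=> A B AF BF; apply: card_common_nbrs; rewrite ?(subsetP FE). Qed.

(** An edge and a neighbour of it both have degree at least 3, and their neighbourhoods are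
    disjoint. Dense families thus enter the induction only from six edges on. *)
Lemma dense_card : F != set0 -> 6 <= #|F|.
Proof.
case/set0Pn => A AF.
apply: leq_trans (deg_upper dense_triangle_free dense_deg AF).
by rewrite (leq_add2r 3 3); apply: dense_deg.
Qed.

Lemma dense_handshake :
  2 * (#|F| * r) <= 2 * #|cover F| + \sum_(A in F) #|nbr (@meets T) F A|.
Proof.
rewrite -sum_nat_const (eq_bigr (fun A : {set T} => #|A|)) => [|A AF].
  exact: handshake dense_triangle_free.
by rewrite (unif (subsetP FE _ AF)).
Qed.
End Dense.

Lemma subsetD1_card F A n : F \subset E -> A \in F -> #|F| = n.+1 ->
  F :\ A \subset E /\ #|F :\ A| = n.
Proof.
move=> FE AF Fn; split; first by apply: subset_trans FE; apply: subD1set.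
by have := cardsD1 A F; rewrite AF Fn => -[].
Qed.

(** The threshold is 1 here, because two edges can already have defect 1. If every edge has two
    shared points, the three edges meet pairwise without being concurrent, against [tri]. *)
Lemma defect3 F : F \subset E -> #|F| = 3 -> defect_le F 2.
Proof.
move=> FE F3.
have [A /andP[/= AF sA]|no] := pickP [pred A in F | shared F A <= 1].
  apply: (@defect_leD1 F A 1 1) => //.
  have [F'E F'2] := subsetD1_card FE AF F3.
  by have := defect_le_small F'E; rewrite F'2; apply.
have sh2 A : A \in F -> 2 <= shared F A.
  by move=> AF; move: (no A); rewrite /= AF /= leqNgt => /negbFE.
have nbrD1 A : A \in F -> nbr (@meets T) F A = F :\ A.
  move=> AF; apply/eqP; rewrite eqEcard nbr_subD1 /=.
  have [_ ->] := subsetD1_card FE AF F3.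
  exact: leq_trans (sh2 A AF) (shared_le_nbr FE AF).
have [A AF] : exists A, A \in F by apply/card_gt0P; rewrite F3.
have [x [y [/mem_shared[xA [B BN xB]] /mem_shared[yA [C CN yC]] xy]]] :=
  card_gt1P (sh2 A AF).
have [BF /meetsP[AB _]] : B \in F /\ meets A B by move: BN; rewrite inE => /andP[].
have [CF /meetsP[AC _]] : C \in F /\ meets A C by move: CN; rewrite inE => /andP[].
have [[AE BE] CE] := (subsetP FE _ AF, subsetP FE _ BF, subsetP FE _ CF).
have BC : B != C.
  by apply: contraNneq xy => BC; apply/eqP; apply: (linear_eq AE BE AB) => //; rewrite BC.
have mBC : meets B C.
  have : C \in nbr (@meets T) F B by rewrite nbrD1 // in_setD1 eq_sym BC.
  by rewrite inE => /andP[].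
have BA : B != A by rewrite eq_sym.
by rewrite (tri BE AE CE mBC BA AC xB xA yA yC) eqxx in xy.
Qed.

Lemma defect_le_lt6 F n : F \subset E -> #|F| = n.+1 -> n < 5 ->
  (forall G : {set {set T}}, G \subset E -> #|G| = n -> defect_le G (2 * (n - 2))) ->
  defect_le F (2 * (n - 2) + 2).
Proof.
move=> FE Fn n5 IH; case: (shared_dichotomy F) => [[A AF sA]|sh].
  have [F'E F'n] := subsetD1_card FE AF Fn.
  exact: (defect_leD1 FE AF) (IH _ F'E F'n) sA.
have := dense_card FE _ sh; rewrite -card_gt0 Fn => /(_ _ isT) H.
by have := H ltac:(lia); lia.
Qed.

Lemma defect4 F : F \subset E -> #|F| = 4 -> defect_le F 4.
Proof. by move=> FE F4; apply: (@defect_le_lt6 F 3) => // G; apply: defect3. Qed.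

Lemma defect5 F : F \subset E -> #|F| = 5 -> defect_le F 6.
Proof. by move=> FE F5; apply: (@defect_le_lt6 F 4) => // G; apply: defect4. Qed.

(** In the second alternative all degrees are 3, so deleting an edge lowers the defect by at most 3.
    Denseness is recorded for the step to seven edges. *)
Lemma defect6 F : F \subset E -> #|F| = 6 ->
  defect_le F 8 \/ (forall A, A \in F -> 3 <= shared F A) /\ defect_le F 9.
Proof.
move=> FE F6; case: (shared_dichotomy F) => [[A AF sA]|sh]; [left|right].
  have [F'E F'5] := subsetD1_card FE AF F6.
  exact: (@defect_leD1 F A 6 2) (defect5 F'E F'5) sA.
split=> //; have F8 : #|F| <= 8 by rewrite F6.
have [A AF] : exists A, A \in F by apply/card_gt0P; rewrite F6.
have [F'E F'5] := subsetD1_card FE AF F6.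
apply: (@defect_leD1 F A 6 3) (defect5 F'E F'5) _ => //.
apply: leq_trans (shared_le_nbr FE AF) _.
by rewrite (six_vertices_deg (dense_triangle_free FE F8 sh) (dense_deg FE sh)).
Qed.

(* If deleting A leaves a 3 x 3 grid, then A meets at most one line of the grid:
   two such lines would be parallel with A as a fourth common neighbour. *)
Lemma shared_over_dense6 F A : F \subset E -> A \in F -> #|F :\ A| = 6 ->
  (forall B, B \in F :\ A -> 3 <= shared (F :\ A) B) -> shared F A <= 1.
Proof.
move=> FE AF F6 sh; rewrite leqNgt; apply/negP => s2.
have F'E : F :\ A \subset E by apply: subset_trans FE; apply: subD1set.
have F'8 : #|F :\ A| <= 8 by rewrite F6.
have tf := dense_triangle_free F'E F'8 sh; have deg3 := dense_deg F'E sh.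
have [x [y [/mem_shared[xA [B BN xB]] /mem_shared[yA [C CN yC]] xy]]] :=
  card_gt1P s2.
have [BF mAB] : B \in F /\ meets A B by move: BN; rewrite inE => /andP[].
have [CF mAC] : C \in F /\ meets A C by move: CN; rewrite inE => /andP[].
have [[AB _] [AC _]] := (meetsP _ _ mAB, meetsP _ _ mAC).
have [[AE BE] CE] := (subsetP FE _ AF, subsetP FE _ BF, subsetP FE _ CF).
have BC : B != C.
  by apply: contraNneq xy => BC; apply/eqP; apply: (linear_eq AE BE AB) => //; rewrite BC.
have BA : B != A by rewrite eq_sym.
have nBC : ~~ meets B C.
  apply/negP => mBC; move/eqP: xy; apply.
  exact: (tri BE AE CE mBC BA AC).
have BF' : B \in F :\ A by rewrite in_setD1 BA.
have CF' : C \in F :\ A by rewrite in_setD1 eq_sym AC.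
have twins := six_vertices_twins meetsC tf deg3 F6 BF' CF' nBC.
have le3 := card_common_nbrs FE BE CE BC nBC.
have : A |: nbr (@meets T) (F :\ A) B \subset
    nbr (@meets T) F B :&: nbr (@meets T) F C.
  rewrite subUset sub1set !inE AF !(meetsC _ A) mAB mAC /=.
  apply/subsetP => D DB; have := DB; rewrite twins; move: DB.
  by rewrite !inE => /andP[/andP[_ ->] ->] /andP[_ ->].
move/subset_leq_card; rewrite cardsU1 (six_vertices_deg tf deg3 F6 BF').
rewrite inE in_setD1 eqxx /= => le4.
by have := leq_trans le4 le3.
Qed.

(** The bound arises as 8 + 2, as 9 + 1 over a dense family of six, or in the dense case as half of
    21, rounded down. *)
Lemma defect7 F : F \subset E -> #|F| = 7 -> defect_le F 10.
Proof.
move=> FE F7; case: (shared_dichotomy F) => [[A AF sA]|sh].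
  have [F'E F'6] := subsetD1_card FE AF F7.
  case: (defect6 F'E F'6) => [d8|[sh d9]].
    exact: (@defect_leD1 F A 8 2).
  exact: (@defect_leD1 F A 9 1) d9 (shared_over_dense6 FE AF F'6 sh).
have F8 : #|F| <= 8 by rewrite F7.
have tf := dense_triangle_free FE F8 sh.
have := seven_vertices meetsC tf (dense_deg FE sh) (dense_few_common_nbrs FE) F7.
have := dense_handshake FE F8 sh; rewrite /defect_le F7.
by move: #|cover F| (\sum_(A in F) _) => c d; lia.
Qed.

(** Deleting an edge gives 10 + 2. In the dense case a degree sum of at most 25 gives 12, and a
    larger one leads to the crown. *)
Lemma defect8 F : F \subset E -> #|F| = 8 -> defect_le F 12.
Proof.
move=> FE F8; case: (shared_dichotomy F) => [[A AF sA]|sh].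
  have [F'E F'7] := subsetD1_card FE AF F8.
  exact: (@defect_leD1 F A 10 2) (defect7 F'E F'7) sA.
have F8' : #|F| <= 8 by rewrite F8.
have tf := dense_triangle_free FE F8' sh.
have := dense_handshake FE F8' sh; rewrite /defect_le F8 => hs.
have [le|gt] := leqP (\sum_(A in F) #|nbr (@meets T) F A|) 25.
  by move: hs le; move: #|cover F| (\sum_(A in F) _) => c d; lia.
have [R [C [[Rinj Cinj] RCF RR CC RC]]] :=
  eight_vertices meetsC tf (dense_deg FE sh) (dense_few_common_nbrs FE) F8 gt.
case: (no_crown Rinj Cinj _ RR CC RC) => i.
by have [RF CF] := RCF i; rewrite !(subsetP FE).
Qed.

(** The theorem takes m = 2(e - 2) and v = er - m - 1. *)
Lemma defect_G_free e m v : (forall F, F \subset E -> #|F| = e -> defect_le F m) ->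
  v + m < e * r -> G_free E v e.
Proof.
move=> d vm F FE Fe; have := d F FE Fe; rewrite /defect_le Fe.
by move: (e * r) vm #|cover F| => a ? b; lia.
Qed.
End Coloring.
End LinearHypergraph.

(** * From forbidden rainbow cycles to conditions on edges and colours *)

Section Rainbow.
Variables (r : nat) (T : finType) (E : {set {set T}}) (P : 'I_r -> {set T}).

Lemma partite_coloring : partite E P -> exists col : T -> 'I_r,
  (forall x, x \in P (col x)) /\
  forall A x y, A \in E -> x \in A -> y \in A -> x != y -> col x != col y.
Proof.
case=> ex1 part.
have [col colP] : exists col : T -> 'I_r, forall x, x \in P (col x).
  by apply: (fin_all_exists (P := fun x i => x \in P i)) => x; have [i []] := ex1 x; exists i.
exists col; split=> // A x y AE xA yA; apply: contraNneq => e.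
have /eq_leq/card_le1_eqP := part A AE (col x).
by move=> /(_ x y) -> //; rewrite inE ?xA ?yA ?colP // e colP.
Qed.

Lemma nth_ord_inj (X : eqType) (x0 : X) (s : seq X) k : size s = k -> uniq s ->
  injective (fun i : 'I_k => nth x0 s i).
Proof.
move=> sk us i j /eqP; rewrite nth_uniq ?sk // => /eqP; exact: val_inj.
Qed.

(** Concrete lists reduce the cyclic incidences to finitely many computed checks; distinct colours
    already make the vertices distinct. *)
Lemma has_rainbow_cycleI (col : T -> 'I_r) k x0 (vs : seq T) (As : seq {set T}) :
  (forall x, x \in P (col x)) -> size vs = k -> size As = k ->
  uniq (map col vs) -> uniq As ->
  (forall i, i < k -> [/\ nth set0 As i \in E, nth x0 vs i \in nth set0 As i &
     nth x0 vs (i.+1 %% k) \in nth set0 As i]) ->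
  has_rainbow_cycle E P k.
Proof.
move=> colP svs sAs ucol uAs cyc.
exists (fun i => nth x0 vs i), (fun i => nth set0 As i); split.
  split=> [||i]; [|exact: nth_ord_inj|exact: cyc].
  by apply: nth_ord_inj => //; apply: map_uniq ucol.
exists (fun i => col (nth x0 vs i)); split=> [i j|i]; last exact: colP.
rewrite -!(nth_map x0 (col x0)) ?svs // => /nth_ord_inj; apply=> //.
by rewrite size_map.
Qed.

Hypothesis lin : linear_hypergraph E.
Variable col : T -> 'I_r.
Hypothesis colP : forall x, x \in P (col x).
Hypothesis col_inj : forall A x y, A \in E -> x \in A -> y \in A -> x != y ->
  col x != col y.

(** Any two corners of a proper triangle lie on a common edge, so their colours differ and the
    triangle is rainbow. *)
Lemma no_rainbow3_triangle : ~ has_rainbow_cycle E P 3 ->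
  forall A B C x y, A \in E -> B \in E -> C \in E ->
    meets A C -> A != B -> B != C ->
    x \in A -> x \in B -> y \in B -> y \in C -> x = y.
Proof.
move=> no3 A B C x y AE BE CE /meetsP[AC [z [zA zC]]] AB BC xA xB yB yC.
apply/eqP/negPn/negP => xy; case: no3.
have yz : y != z.
  by apply: contraNneq xy => yz; subst z; apply/eqP; apply: (linear_eq lin AE BE AB).
have zx : z != x.
  by apply: contraNneq xy => zx; subst z; apply/eqP; apply: (linear_eq lin BE CE BC).
have xz : x != z by rewrite eq_sym.
(* Each edge must contain the vertex of its index and the next one: [B] carries [x], [y], then [C]
   carries [y], [z], and [A] closes the cycle. *)
apply: (@has_rainbow_cycleI col 3 x [:: x; y; z] [:: B; C; A]) => //.
- by rewrite /= !inE negb_or (col_inj BE xB yB) // (col_inj AE xA zA) // (col_inj CE yC zC).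
- by rewrite /= !inE negb_or BC (eq_sym B) AB eq_sym AC.
- by case=> [|[|[|]]].
Qed.

(** Consecutive corners lie on a common edge and so differ in colour, which leaves only the
    diagonals to agree. Disjointness of opposite edges makes consecutive corners and consecutive
    edges distinct. *)
Lemma no_rainbow4_quad : ~ has_rainbow_cycle E P 4 ->
  forall A B C D x y z w, A \in E -> B \in E -> C \in E -> D \in E ->
    A != C -> ~~ meets A C -> B != D -> ~~ meets B D ->
    x \in A -> x \in B -> y \in B -> y \in C ->
    z \in C -> z \in D -> w \in D -> w \in A -> col x = col z \/ col y = col w.
Proof.
move=> no4 A B C D x y z w AE BE CE DE AC nAC BD nBD xA xB yB yC zC zD wD wA.
have [->|xz] := eqVneq (col x) (col z); first by left.
have [->|yw] := eqVneq (col y) (col w); first by right.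
have AC0 u : u \in A -> u \in C -> False := not_meets AC nAC.
have BD0 u : u \in B -> u \in D -> False := not_meets BD nBD.
have xy : x != y by apply/eqP => e; subst y; apply: (AC0 x).
have yz : y != z by apply/eqP => e; subst z; apply: (BD0 y).
have zw : z != w by apply/eqP => e; subst w; apply: (AC0 z).
have xw : x != w by apply/eqP => e; subst w; apply: (BD0 x).
have AB : A != B by apply/eqP => e; subst B; apply: (AC0 y).
have BC : B != C by apply/eqP => e; subst C; apply: (AC0 x).
have CD : C != D by apply/eqP => e; subst D; apply: (BD0 y).
have DA : D != A by apply/eqP => e; subst D; apply: (BD0 x).
case: no4; apply: (@has_rainbow_cycleI col 4 x [:: x; y; z; w] [:: B; C; D; A]) => //.
- rewrite /= !inE !negb_or xz yw (col_inj BE xB yB) // (col_inj AE xA wA) //.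
  by rewrite (col_inj CE yC zC) // (col_inj DE zD wD).
- by rewrite /= !inE !negb_or BC BD CD DA (eq_sym B) AB (eq_sym C) AC.
- by case=> [|[|[|[|]]]].
Qed.
End Rainbow.

Theorem theorem3 (r : nat) (T : finType) (E : {set {set T}})
    (P : 'I_r -> {set T}) :
  3 <= r ->
  uniform E r ->
  partite E P ->
  linear_hypergraph E ->
  ~ has_rainbow_cycle E P 3 ->
  ~ has_rainbow_cycle E P 4 ->
  [/\ G_free E (3 * r - 3) 3,
      G_free E (4 * r - 5) 4,
      G_free E (5 * r - 7) 5,
      G_free E (7 * r - 11) 7 &
      G_free E (8 * r - 13) 8].
Proof.
move=> r3 unif part lin no3 no4.
have [col [colP col_inj]] := partite_coloring part.
have tri := no_rainbow3_triangle lin colP col_inj no3.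
have quad := no_rainbow4_quad colP col_inj no4.
split.
- by apply: defect_G_free (defect3 lin tri unif) _; lia.
- by apply: defect_G_free (defect4 lin tri unif) _; lia.
- by apply: defect_G_free (defect5 lin tri unif) _; lia.
- by apply: defect_G_free (defect7 lin tri col_inj quad unif) _; lia.
- by apply: defect_G_free (defect8 lin tri col_inj quad unif) _; lia.
Qed.
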